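(* Let $v$ be a radial mapping and let $u$ be a Borel function on $D$ having radial limits $\tilde u$ $\mu$-a.e. with respect to $v$, where $\tilde u$ is a real $\mu$-measurable function on $K_0$. Then $u$ has boundary values equal to $\tilde u$.
   Context: Standing setting: $D$ is a bounded domain in $\mathbb R^n$ exhausted by domains $D_r$, $r<0$, with $D_r\Subset D_s$ for $r<s<0$ and $\bigcup_{r<0}D_r=D$; $S_r=\partial D_r$. For each $r<0$, $\mu_r$ is a finite positive regular Borel measure supported on $S_r$, and $\mu_r\to\mu$ weak-* in $C(\overline D)^*$ as $r\to0^-$, where $\mu$ is a finite positive measure supported on $\partial D$; $K_0=\operatorname{supp}\mu$. For a sequence $r_j\nearrow0$ and functions $\phi_j$ on $\operatorname{supp}\mu_{r_j}$, $\{\phi_j\}$ has strong limit values $\phi^*$ (a real $\mu$-measurable function on $K_0$) if for all real $a<b$ and $\varepsilon,\delta>0$ there are $j_0$ and an open set $O\subset\overline D$ containing $\{x\in K_0:a\le\phi^*(x)<b\}$ with $\mu_{r_j}(\{\phi_j<a-\varepsilon\}\cap O)+\mu_{r_j}(\{\phi_j>b+\varepsilon\}\cap O)<\delta$ for $j\ge j_0$. A function $u$ on $D$ has boundary values $u^*$ if for every sequence $r_j\nearrow0$ the sequence $\{u|_{\operatorname{supp}\mu_{r_j}}\}$ has strong limit values with respect to $\{\mu_{r_j}\}$, equal to $u^*$ ($\mu$-a.e.) independently of the sequence. A continuous map $v:K_0\times[0,\varepsilon_0)\to\mathbb R^n$ ($\varepsilon_0>0$) is radial if: (i) $v(\zeta,0)=\zeta$;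 (ii) there is $r_0<0$ such that for every $\zeta\in K_0$ and every $r\in(r_0,0)$ the set $\{t:v(\zeta,t)\in S_r\}$ is nonempty, and the functions $t_r(\zeta)=\inf\{t:v(\zeta,t)\in S_r\}$ are continuous on $K_0$ and converge uniformly to $0$ as $r\to0^-$; (iii) there is $c>0$ such that for every Borel $E\subset K_0$, with $E_r=\{v(\zeta,t_r(\zeta)):\zeta\in E\}$, $\limsup_{r\to0^-}\mu_r(E_r)\le c\mu(E)$; (iv) with $A_r=\{v(\zeta,t_r(\zeta)):\zeta\in K_0\}$, $\limsup_{r\to0^-}\mu_r(S_r\setminus A_r)=0$. A function $u$ on $D$ has radial limits $\tilde u$ $\mu$-a.e. with respect to $v$ if $\lim_{t\to0^+}u(v(\zeta,t))$ exists and equals $\tilde u(\zeta)$ for $\mu$-a.e. $\zeta\in K_0$. *)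

(* Defs.v *)
From HB Require Import structures.
From mathcomp Require Import all_boot all_order all_algebra.
From mathcomp Require Import all_classical all_reals all_analysis.
Set Implicit Arguments. Unset Strict Implicit. Unset Printing Implicit Defensive.
Import Order.TTheory GRing.Theory Num.Theory.
Import numFieldNormedType.Exports.
Local Open Scope classical_set_scope.
Local Open Scope ring_scope.

Definition borelE (R : realType) (n : nat) :=
  g_sigma_algebraType (@open 'rV[R]_n).

Notation bmeasure R n := {measure set (borelE R n) -> \bar R}.

Section defs.
Context {R : realType} {n : nat}.
Local Notation E := 'rV[R]_n.

Definition bd (A : set E) : set E := closure A `\` interior A.

Definition domain (A : set E) : Prop := A !=set0 /\ open A /\ connected A.

Definition msupp (m : bmeasure R n) : set E :=
  [set x | forall U : set E, open U -> U x -> (0 < m U)%E].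

Definition regular (m : bmeasure R n) : Prop :=
  forall A : set (borelE R n), measurable A ->
    m A = ereal_inf [set m U | U in [set U : set E | open U /\ A `<=` U]] /\
    m A = ereal_sup [set m K | K in [set K : set E | compact K /\ K `<=` A]].

(* outer measure (used for images E_r, A_r which need not be Borel a priori) *)
Definition outer (m : bmeasure R n) (A : set E) : \bar R :=
  ereal_inf [set m B | B in [set B : set (borelE R n) | measurable B /\ A `<=` B]].

Definition mu_mset (m : bmeasure R n) (A : set E) : Prop :=
  exists B C : set (borelE R n), [/\ measurable B, measurable C,
    B `<=` A, A `<=` C & m (C `\` B) = 0%E].

Definition mu_mfun (m : bmeasure R n) (K : set E) (f : E -> R) : Prop :=
  forall a : R, mu_mset m (K `&` [set x | f x < a]).

Definition standing (D : set E) (Dr : R -> set E) (mur : R -> bmeasure R n)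
    (mu : bmeasure R n) : Prop :=
  [/\ domain D /\ bounded_set D,
      (forall r, r < 0 -> domain (Dr r)),
      (forall r s, r < s -> s < 0 -> compact (closure (Dr r)) /\ closure (Dr r) `<=` Dr s),
      \bigcup_(r in [set r : R | r < 0]) Dr r = D &
      [/\ (forall r, r < 0 -> (mur r setT < +oo)%E /\ regular (mur r)
                              /\ mur r (~` bd (Dr r)) = 0%E),
          (forall f : E -> R, {within closure D, continuous f} ->
             (fun r => (\int[mur r]_(x in closure D) (f x)%:E)%E) @ 0^'-
               --> (\int[mu]_(x in closure D) (f x)%:E)%E),
          (mu setT < +oo)%E &
          mu (~` bd D) = 0%E]].

(* {phi_j} (here all phi_j = u restricted to supp mu_{r_j}) has strong limit
   values phistar with respect to {mu_{r_j}} *)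
Definition strong_limit_values (D : set E) (nu : nat -> bmeasure R n)
    (K0 : set E) (u : E -> R) (phistar : E -> R) : Prop :=
  forall a b : R, a < b -> forall eps delta : R, 0 < eps -> 0 < delta ->
    exists j0 : nat, exists W : set E, open W /\
      [set x | K0 x /\ a <= phistar x < b] `<=` W `&` closure D /\
      forall j, (j0 <= j)%N ->
        (nu j ([set x | msupp (nu j) x /\ (u x < a - eps)%R] `&` (W `&` closure D))
       + nu j ([set x | msupp (nu j) x /\ (u x > b + eps)%R] `&` (W `&` closure D))
         < (delta%:E))%E.

Definition has_boundary_values (D : set E) (Dr : R -> set E)
    (mur : R -> bmeasure R n) (mu : bmeasure R n) (u ustar : E -> R) : Prop :=
  forall rj : nat -> R, (forall j, rj j < 0) -> {homo rj : i j / (i <= j)%N >-> i <= j} ->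
    rj @ \oo --> (0 : R) ->
    exists phistar : E -> R, mu_mfun mu (msupp mu) phistar /\
      strong_limit_values D (fun j => mur (rj j)) (msupp mu) u phistar /\
      {ae mu, forall x : borelE R n, msupp mu x -> phistar x = ustar x}.

Definition tr (Dr : R -> set E) (v : E -> R -> E) (eps0 r : R) (z : E) : R :=
  inf [set t : R | 0 <= t < eps0 /\ bd (Dr r) (v z t)].

Definition radial (Dr : R -> set E) (mur : R -> bmeasure R n) (mu : bmeasure R n)
    (v : E -> R -> E) (eps0 : R) : Prop :=
  let K0 := msupp mu in
  [/\ 0 < eps0 /\
      {within [set p : E * R | K0 p.1 /\ 0 <= p.2 < eps0],
         continuous (fun p : E * R => v p.1 p.2)},
      (forall z, K0 z -> v z 0 = z),
      (exists r0 : R, r0 < 0 /\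
        (forall z r, K0 z -> r0 < r < 0 ->
           exists t, 0 <= t < eps0 /\ bd (Dr r) (v z t)) /\
        (forall r, r0 < r < 0 -> {within K0, continuous (tr Dr v eps0 r)}) /\
        (forall e : R, 0 < e -> exists d : R, 0 < d /\
           forall r, r0 < r < 0 -> - d < r -> forall z, K0 z -> `|tr Dr v eps0 r z| < e)),
      (exists c : R, 0 < c /\
        forall A : set (borelE R n), measurable A -> A `<=` K0 ->
          forall e : R, 0 < e -> exists d : R, 0 < d /\
            forall r, - d < r < 0 ->
              (outer (mur r) [set v z (tr Dr v eps0 r z) | z in A]
                 <= c%:E * mu A + e%:E)%E) &
      (forall e : R, 0 < e -> exists d : R, 0 < d /\
         forall r, - d < r < 0 ->
           (outer (mur r) (bd (Dr r) `\` [set v z (tr Dr v eps0 r z) | z in K0])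
              <= e%:E)%E)].

End defs.

(* Main.v *)
Require Import Defs.
From HB Require Import structures.
From mathcomp Require Import all_boot all_order all_algebra.
From mathcomp Require Import all_classical all_reals all_analysis.
From mathcomp Require Import lra.
Import Order.TTheory GRing.Theory Num.Theory.
Import numFieldNormedType.Exports.
Local Open Scope classical_set_scope.
Local Open Scope ring_scope.

(* Fix r_j -> 0 and let g_j(z) be the point where the radial curve through z
   first meets S_{r_j}.  The set A_j of those z in K0 at which u(g_j(z)) leaves
   [a - eps, b + eps] is Borel, and, by the radial limits, the limsup of the A_j
   meets {a <= ut < b} only in a null set.  Hence there are J and a closed set L,
   disjoint from {a <= ut < b}, such that the union of the A_j with j >= J has
   small mu-measure outside L.  Take for O the complement of the closure of the
   union of the images g_j(L): since g_j tends to the identity uniformly, this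
   closure meets bd D only inside L, so O contains {a <= ut < b}.  For large j a
   bad point of O on S_{r_j} is either not of the form g_j(z), which is
   controlled by (iv), or is g_j(z) with z in some A_j but outside L, which is
   controlled by (iii).  Working with sequences and not with the whole limit
   t -> 0+ keeps all these sets Borel, with no measurable projection. *)

(** * Regularity of finite Borel measures *)

Lemma decreasing_measure_tail (d : measure_display) (T : measurableType d)
    (R : realType) (mu : {measure set T -> \bar R}) (F : nat -> set T) :
  (mu setT < +oo)%E -> (forall i, measurable (F i)) ->
  (forall i j, (i <= j)%N -> F j `<=` F i) ->
  forall e : R, 0 < e -> exists N, (mu (F N `\` \bigcap_i F i) < e%:E)%E.
Proof.
move=> muT mF dF e e0.
have mI : measurable (\bigcap_i F i) by exact: bigcap_measurable.
pose G i := F i `\` \bigcap_i F i.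
have mG i : measurable (G i) by exact: measurableD.
have G0 : \bigcap_i G i = set0.
  by rewrite -subset0 => x Gx; have [_] := Gx 0%N I; apply=> i _; have [] := Gx i I.
have cvgG : (mu \o G) x @[x --> \oo] --> mu (\bigcap_i G i).
  apply: nonincreasing_cvg_mu => //; last 2 first.
  - by rewrite G0.
  - by move=> i j ij; apply/subsetPset; apply: setSD; exact: dF.
  by apply: le_lt_trans muT; apply: le_measure; rewrite ?inE.
rewrite G0 measure0 in cvgG.
have /cvgG [N _ /(_ N (leqnn N))] : nbhs (0 : \bar R)%E [set y | (y < e%:E)%E].
  by apply: open_nbhs_nbhs; split; [exact: open_ereal_lt_ereal|rewrite /= lte_fin].
by exists N.
Qed.

Section borel.
Context {R : realType} {n : nat}.
Local Notation E := 'rV[R]_n.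
Implicit Types (A B : set (borelE R n)) (mu : bmeasure R n).

Lemma borelE_open (A : set E) : open A -> measurable (A : set (borelE R n)).
Proof. by move=> oA; exact: sub_gen_smallest. Qed.

Lemma borelE_closed (A : set E) : closed A -> measurable (A : set (borelE R n)).
Proof.
move=> cA; rewrite -(setCK A); apply: measurableC.
by apply: borelE_open; exact: closed_openC.
Qed.

(** [V k] is an open set of points close to the complement of [U]. As [U] is open, its traces on the
    [V k] shrink to the empty set, and the complement of a late [V N] serves as [F]. *)
Lemma open_inner_regular mu (U : set E) : (mu setT < +oo)%E -> open U ->
  forall e : R, 0 < e -> exists F : set E,
    [/\ closed F, F `<=` U & (mu (U `\` F) < e%:E)%E].
Proof.
move=> muT oU e e0.
pose V k : set E := \bigcup_(y in ~` U) interior (ball y (k.+1%:R^-1 : R)).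
have oV k : open (V k) by apply: bigcup_open => y _; exact: open_interior.
have UV0 : \bigcap_k (U `&` V k) = set0.
  rewrite -subset0 => x UVx.
  have [Ux _] := UVx 0%N I.
  have /nbhs_ballP[r /= r0 xrU] : nbhs x U by exact: open_nbhs_nbhs.
  have [k kr] : exists k : nat, k.+1%:R^-1 < r.
    exists (Num.trunc r^-1); rewrite invf_plt ?posrE ?ltr0n//.
    by rewrite truncnS_gt.
  have [_ [y nUy /interior_subset yx]] := UVx k I.
  by apply: nUy; apply: xrU; apply: (le_ball (ltW kr)); exact: ball_sym.
have [||N] := @decreasing_measure_tail _ _ _ mu (fun k => U `&` V k) muT _ _ e e0.
- by move=> k; apply: measurableI; exact: borelE_open.
- move=> i j ij x [Ux [y nUy yx]]; split=> //; exists y => //.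
  apply: interiorS yx; apply: le_ball.
  by rewrite lef_pV2 ?posrE ?ltr0n// ler_nat ltnS.
rewrite UV0 setD0 => muN; exists (~` V N); split.
- exact: open_closedC.
- move=> x; apply: contra_notP => nUx; exists x => //.
  by apply: nbhsx_ballx; rewrite invr_gt0 ltr0n.
- by rewrite setDE setCK.
Qed.

(* The closed/open sandwich is the property stable under complement; countable
   unions use finitely many of the closed sets. *)
Lemma finite_borel_regular mu A : (mu setT < +oo)%E -> measurable A ->
  forall e : R, 0 < e -> exists F U : set E,
    [/\ closed F, open U, F `<=` A, A `<=` U & (mu (U `\` F) < e%:E)%E].
Proof.
move=> muT.
pose P (B : set E) := forall e : R, 0 < e -> exists F U : set E,
    [/\ closed F, open U, F `<=` B, B `<=` U & (mu (U `\` F) < e%:E)%E].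
apply: (@smallest_sub _ (sigma_algebra setT) open P); last first.
  move=> U oU e e0; have [F [cF FU muF]] := open_inner_regular _ _ muT oU _ e0.
  by exists F, U; split.
split.
- move=> e e0; exists set0, set0; split=> //.
  + exact: closed0.
  + by rewrite setD0 measure0 lte_fin.
- move=> B PB e e0; have [F [U [cF oU FB BU muF]]] := PB e e0.
  exists (~` U), (~` F); split.
  + exact: open_closedC.
  + exact: closed_openC.
  + by rewrite setTD; exact: subsetC.
  + by rewrite setTD; exact: subsetC.
  + by rewrite setDE setCK setIC -setDE.
- move=> B PB e e0.
  have e20 : 0 < e / 2 by rewrite divr_gt0.
  have /choice[F /choice[U FU]] : forall k, exists F U : set E,
      [/\ closed F, open U, F `<=` B k, B k `<=` U &
        (mu (U `\` F) < (e / 2 / (2 ^ k.+1)%:R)%:E)%E].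
    by move=> k; apply: PB; rewrite divr_gt0// ltr0n expn_gt0.
  have cF k : closed (F k) by have [] := FU k.
  have oU k : open (U k) by have [] := FU k.
  pose V := \bigcup_k U k.
  have oV : open V by exact: bigcup_open.
  pose H N := \bigcup_(k in `I_N) F k.
  have cH N : closed (H N) by apply: closed_bigcup => //; exact: finite_II.
  have mVH N : measurable (V `\` H N : set (borelE R n)).
    by apply: measurableD; [exact: borelE_open|exact: borelE_closed].
  have [||N muN] := @decreasing_measure_tail _ _ _ mu (fun N => V `\` H N) muT _ _ _ e20.
  + by [].
  + move=> i j ij; apply: setDS => x [k /= ki Fkx]; exists k => //=.
    exact: leq_trans ij.
  exists (H N), V; split=> //.
  + by move=> x [k _ Fkx]; exists k => //; have [_ _ + _ _] := FU k; exact.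
  + by move=> x [k _ Bkx]; exists k => //; have [_ _ _ + _] := FU k; exact.
  have mI : measurable (\bigcap_N (V `\` H N) : set (borelE R n)).
    exact: bigcap_measurable.
  (* The intersection is [V] minus every [F k], hence covered by the [U k] minus [F k], whose
     measures sum to at most [e / 2]. *)
  have muI : (mu (\bigcap_N (V `\` H N)) <= (e / 2)%:E)%E.
    apply: le_trans (epsilon_trick0 xpredT (ltW e20)).
    have mUF k : measurable (U k `\` F k : set (borelE R n)).
      by apply: measurableD; [exact: borelE_open|exact: borelE_closed].
    apply: (le_trans (measure_sigma_subadditive mu mUF mI _)).
      move=> x VHx; have [[k _ Ukx] _] := VHx 0%N I; exists k => //; split=> // Fkx.
      (* The index set of [H N] stops before [N], so [F k] first enters at [H k.+1]. *)
      by have [_] := VHx k.+1 I; apply; exists k => /=.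
    by apply: lee_nneseries => // k _; have [_ _ _ _ /ltW] := FU k.
  have fI : mu (\bigcap_N (V `\` H N)) \is a fin_num.
    by rewrite ge0_fin_numE// (le_lt_trans muI) ?ltry.
  rewrite [e]splitr EFinD; apply: le_lt_trans (lte_leD fI muN muI) => //.
  rewrite -measureU//; last 2 first.
  + exact: measurableD.
  + by rewrite setDKI.
  apply: le_measure; rewrite ?inE//.
    by apply: measurableU => //; exact: measurableD.
  by move=> x VHx; have [Ix|nIx] := pselect ((\bigcap_N (V `\` H N)) x);
    [right|left].
Qed.

(** * Boundaries, supports and continuous maps *)

Lemma closed_bd (A : set E) : closed (bd A).
Proof.
apply: closedI; first exact: closed_closure.
by apply: open_closedC; exact: open_interior.
Qed.

Lemma closed_msupp mu : closed (msupp mu).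
Proof.
rewrite -(setCK (msupp mu)); apply: open_closedC; rewrite openE => x /existsNP[U].
move=> /not_implyP[oU /not_implyP[Ux muU]].
apply: filterS (open_nbhs_nbhs (conj oU Ux)) => y Uy suppy.
by apply: muU; exact: suppy.
Qed.

Lemma msupp_sub mu (F : set E) : closed F -> mu (~` F) = 0%E -> msupp mu `<=` F.
Proof.
move=> cF muF x suppx; apply: contrapT => nFx.
by have := suppx _ (closed_openC cF) nFx; rewrite muF ltxx.
Qed.

Lemma within_continuous_measurable (K : set E) (g : E -> E) : closed K ->
  {within K, continuous g} ->
  measurable_fun (K : set (borelE R n)) (g : borelE R n -> borelE R n).
Proof.
move=> cK /continuousP cg; apply: (@measurability _ _ (borelE R n) (borelE R n) K g (@open E)) => //.
move=> _ [U oU <-].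
have /open_subspaceP[V oV VK] := cg _ oU.
rewrite setIC -VK; apply: measurableI; first exact: borelE_open.
exact: borelE_closed.
Qed.

(** * Hitting points of the radial curves *)

Section radial_map.
Variables (Dr : R -> set E) (v : E -> R -> E) (eps0 : R) (K : set E).
Hypothesis cv : {within [set p : E * R | K p.1 /\ 0 <= p.2 < eps0],
  continuous (fun p : E * R => v p.1 p.2)}.

Let hit (r : R) (z : E) := [set t : R | 0 <= t < eps0 /\ bd (Dr r) (v z t)].

(** The boundary is closed: missing it at the infimum [s] would mean missing it at all admissible
    times near [s], yet hitting times come arbitrarily close to [s]. *)
Lemma tr_attained r z : K z -> hit r z !=set0 -> hit r z (tr Dr v eps0 r z).
Proof.
move=> Kz [t0 Tt0]; set s := tr _ _ _ _ _; rewrite /= in Tt0.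
have lbT : has_lbound (hit r z) by exists 0 => t [/andP[]].
have s0 : 0 <= s by apply: lb_le_inf; [exists t0|move=> t [/andP[]]].
have seps : s < eps0.
  by have [/andP[_ t0eps] _] := Tt0; apply: le_lt_trans t0eps; exact: ge_inf.
split; first by rewrite s0.
rewrite -/s.
apply: contrapT => nbd.
have onbd : open (~` bd (Dr r)) by apply: closed_openC; exact: closed_bd.
have /subspace_continuousP/(_ (z, s)) := cv.
have sdom : 0 <= s < eps0 by rewrite s0.
move=> /(_ (conj Kz sdom)) /= cvs.
have /cvs : nbhs (v z s) (~` bd (Dr r)) by exact: open_nbhs_nbhs.
rewrite /= !nbhs_simpl/= /within => -[[A B] /= [Az]].
move=> /nbhs_ballP[e /= e0 seB] AB.
have [t Tt ts] := inf_adherent e0 (conj (ex_intro _ t0 Tt0) lbT).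
have [/andP[t0' teps] bdt] := Tt.
apply: (AB (z, t)) bdt; last by split=> //=; rewrite t0'.
split=> /=; first exact: nbhs_singleton.
apply: seB; rewrite /ball/= distrC ger0_norm ?subr_ge0; last exact: ge_inf.
by rewrite ltrBlDl.
Qed.

Lemma within_continuous_radial (t : E -> R) :
  (forall z, K z -> 0 <= t z < eps0) -> {within K, continuous t} ->
  {within K, continuous (fun z => v z (t z))}.
Proof.
move=> teps /subspace_continuousP ct; apply/subspace_continuousP => z Kz.
have /subspace_continuousP/(_ (z, t z)) := cv.
move=> /(_ (conj Kz (teps z Kz))) /= cvz U /cvz.
rewrite /= !nbhs_simpl/= /within => -[[A B] /= [Az Btz] AB].
have Bz : \forall y \near z, K y -> B (t y) by exact: ct Btz.
near=> y => Ky; apply: (AB (y, t y)); last by split=> //=; exact: teps.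
by split=> /=; [near: y|apply: (near Bz y)].
Unshelve. all: by end_near. Qed.

(** Compactness turns continuity of [v] at each [(z, 0)] into one time threshold for all of [K].
    Uniformly small hitting times then give hitting points uniformly close to their base points. *)
Lemma radial_uniformly_close : compact K -> (forall z, K z -> v z 0 = z) ->
  0 < eps0 -> forall e, 0 < e -> \forall t \near (0 : R),
    forall z, K z -> 0 <= t < eps0 -> ball z e (v z t).
Proof.
move=> /compact_near_coveringP/near_covering_withinP cK v0 e00 e e0.
apply: (cK _ (nbhs (0 : R)) (fun t z => 0 <= t < eps0 -> ball z e (v z t))).
move=> z Kz.
have /subspace_continuousP/(_ (z, 0)) := cv.
have e20 : 0 < e / 2 by rewrite divr_gt0.
have eps00 : 0 <= (0 : R) < eps0 by rewrite lexx.
move=> /(_ (conj Kz eps00)) /(_ (ball z (e / 2))).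
rewrite /from_subspace/= v0// => /(_ (nbhsx_ballx _ _ e20)) [[A B] /= [Az B0] AB].
near=> y t => Ky teps; apply: (@ball_splitr _ _ z).
  by near: y; exact: nbhsx_ballx.
apply: (AB (y, t)) => //; split=> /=.
  by near: y.
by near: t.
Unshelve. all: by end_near. Qed.

End radial_map.

(** * Covering estimates, limsup sets and closures of images *)

Lemma lt_measure_outerU mu A (P Q : set E) (x y : \bar R) : measurable A ->
  A `<=` P `|` Q -> (outer mu P < x)%E -> (outer mu Q < y)%E -> (mu A < x + y)%E.
Proof.
move=> mA APQ /ereal_inf_lt[_ [B [mB PB] <-] Bx].
move=> /ereal_inf_lt[_ [C [mC QC] <-] Cy].
apply: le_lt_trans (lteD Bx Cy).
apply: le_trans (measureU2 mu mB mC).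
apply: le_measure; rewrite ?inE//; first exact: measurableU.
by move=> z /APQ[/PB|/QC]; [left|right].
Qed.

(** Half of [e] pays for replacing a late tail union by the limsup, the other half for a closed set
    inside the limsup stripped of a measurable null set containing [N]. *)
Lemma limsup_closed_approx mu (A : nat -> set (borelE R n)) (N : set (borelE R n)) :
  (mu setT < +oo)%E -> (forall j, measurable (A j)) -> mu.-negligible N ->
  forall e : R, 0 < e -> exists (L : set E) (J : nat),
    [/\ closed L, L `<=` (\bigcap_i \bigcup_(j in [set j | (i <= j)%N]) A j) `\` N &
      (mu ((\bigcup_(j in [set j | (J <= j)%N]) A j) `\` L) < e%:E)%E].
Proof.
move=> muT mA [N' [mN' muN' NN']] e e0.
have e20 : 0 < e / 2 by rewrite divr_gt0.
pose F i := \bigcup_(j in [set j | (i <= j)%N]) A j.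
have mF i : measurable (F i) by exact: bigcup_measurable.
have mI : measurable (\bigcap_i F i) by exact: bigcap_measurable.
have [||J muJ] := @decreasing_measure_tail _ _ _ mu F muT _ _ _ e20.
- by [].
- by move=> i j ij x [k /= jk Akx]; exists k => //=; exact: leq_trans jk.
have mIN : measurable (\bigcap_i F i `\` N') by exact: measurableD.
have [L [U [cL oU LI IU muU]]] := finite_borel_regular _ _ muT mIN _ e20.
have mL := borelE_closed _ cL; have mU := borelE_open _ oU.
exists L, J; split=> //.
  by move=> x /LI [Fx nN'x]; split=> // /NN'.
have muE : (mu (F J `\` \bigcap_i F i) + mu (U `\` L) < e%:E)%E.
  by rewrite [e]splitr EFinD; exact: lteD.
apply: le_lt_trans muE.
have mFI : measurable (F J `\` \bigcap_i F i) by exact: measurableD.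
have mUL : measurable (U `\` L : set (borelE R n)) by exact: measurableD.
apply: le_trans (measureU2 mu mFI mUL).
have mFU := measurableU _ _ mFI mUL.
(* [L] avoids [N'], so [N'] has to join the cover; being null, it costs nothing. *)
rewrite -[leRHS]adde0 -muN'; apply: le_trans (measureU2 mu mFU mN').
apply: le_measure; rewrite ?inE.
- by apply: measurableD => //; exact: mF.
- exact: measurableU.
move=> x [FJx nLx]; have [N'x|nN'x] := pselect (N' x); [by right|left].
have [Ix|nIx] := pselect ((\bigcap_i F i) x); [right|left] => //.
by split=> //; apply: IU.
Qed.

(** Near a point of [B] only late images matter, since the closed set [C j0] misses [B] and contains
    all earlier ones. The late images lie within [e / 2] of the closed set [L]. *)
Lemma closure_bigcup_images (g : nat -> E -> E) (C : nat -> set E) (L B : set E) :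
  closed L -> (forall j, closed (C j)) ->
  (forall i j, (i <= j)%N -> C i `<=` C j) -> (forall j, C j `&` B = set0) ->
  (forall j z, L z -> C j (g j z)) ->
  (forall e : R, 0 < e -> exists j0, forall j, (j0 <= j)%N ->
    forall z, L z -> ball z e (g j z)) ->
  closure (\bigcup_j g j @` L) `&` B `<=` L.
Proof.
move=> cL cC homoC CB gC gclose x [clx Bx]; apply: contrapT => nLx.
have /nbhs_ballP[e /= e0 eL] : nbhs x (~` L).
  by apply: open_nbhs_nbhs; split=> //; exact: closed_openC.
have e20 : 0 < e / 2 by rewrite divr_gt0.
have [j0 gj0] := gclose _ e20.
have nCx : nbhs x (~` C j0).
  apply: open_nbhs_nbhs; split; first exact: closed_openC.
  by move=> Cx; have : (C j0 `&` B) x by []; rewrite CB.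
have [_ [[j _ [z Lz <-]] [nCg xg]]] := clx _ (filterI nCx (nbhsx_ballx _ _ e20)).
have [j0j|jj0] := leqP j0 j.
  by apply: (eL z) => //; apply: ball_splitl xg _; exact: gj0.
by apply: nCg; apply: homoC (gC _ _ Lz); exact: ltnW.
Qed.

Lemma bounded_closure (A : set E) : bounded_set A -> bounded_set (closure A).
Proof.
move=> [M [Mr AM]]; exists M; split=> // N MN x clx.
have cN : closed [set y : E | `|y| <= N].
  apply: (@preimage_closed _ _ (fun y : E => `|y|) [set y | y <= N]).
    by move=> y _; exact: norm_continuous.
  exact: closed_le.
by apply: cN; apply: closure_subset clx => y /(AM N MN).
Qed.

End borel.

(** * From radial limits to boundary values *)

Theorem theorem5p5 (R : realType) (n : nat) (D : set 'rV[R]_n)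
    (Dr : R -> set 'rV[R]_n) (mur : R -> bmeasure R n) (mu : bmeasure R n)
    (v : 'rV[R]_n -> R -> 'rV[R]_n) (eps0 : R) (u ut : 'rV[R]_n -> R) :
  standing D Dr mur mu ->
  radial Dr mur mu v eps0 ->
  measurable_fun (D : set (borelE R n)) (u : borelE R n -> R) ->
  mu_mfun mu (msupp mu) ut ->
  {ae mu, forall z : borelE R n, msupp mu z ->
     (fun t : R => u (v z t)) @ 0^'+ --> ut z} ->
  has_boundary_values D Dr mur mu u ut.
Proof.
have BadN (a b e x y : R) : a <= x < b -> `|x - y| < e ->
    ~ (y < a - e \/ b + e < y).
  by rewrite ltr_norml => /andP[? ?] /andP[? ?] [?|?]; lra.
move=> [[domD bD] _ Dr_nest DrD [murP _ muT muD]].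
move=> [[e00 cv] v0 [r0 [r00 [hitP [ctr tr0]]]] [c [c0 imP]] missP] mu_u mu_ut radlim.
move=> rj rj0 homo_rj cvg_rj; exists ut; split=> //; split; last exact: aeW.
move=> a b ab eps delta eps_gt0 delta_gt0.
have [_ [oD _]] := domD.
pose Bad : set R := [set y | y < a - eps \/ b + eps < y].
(* Four quarters of [delta]: values too low or too high, each at missed points or at hitting points.
   The sixteenths give strict inequalities, and the image estimate uses two of them. *)
have del_lt : delta / 16 < delta / 4 by lra.
have del2_lt : delta / 16 + delta / 16 < delta / 4 by lra.
have deltaE : delta = (delta / 4 + delta / 4) + (delta / 4 + delta / 4) by lra.
have rjP d : 0 < d -> exists j0, forall j, (j0 <= j)%N -> - d < rj j.
  move=> d0; have /cvgrPdist_lt/(_ _ d0)[j0 _ j0P] := cvg_rj.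
  by exists j0 => j /j0P /=; rewrite sub0r normrN ltr0_norm// ltrNl.
have [j1 j1P] : exists j0, forall j, (j0 <= j)%N -> r0 < rj j.
  by have [|j0 j0P] := rjP (- r0); [rewrite oppr_gt0|exists j0 => j /j0P; rewrite opprK].
(* The shift puts every [s k] in the range where all radial curves meet the boundary. *)
pose s k := rj (j1 + k)%N.
have s0 k : r0 < s k < 0 by rewrite j1P ?leq_addr//= rj0.
have sP d : 0 < d -> exists k0, forall k, (k0 <= k)%N -> - d < s k.
  move=> /rjP[k0 k0P]; exists k0 => k k0k; apply: k0P.
  by rewrite (leq_trans k0k)// leq_addl.
set K0 := msupp mu.
have cK0 : closed K0 by exact: closed_msupp.
have K0D : K0 `<=` bd D by apply: msupp_sub => //; exact: closed_bd.
have cptK0 : compact K0.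
  apply: (@subclosed_compact _ _ (closure D)) => //.
    by apply: bounded_closed_compact; [exact: bounded_closure|exact: closed_closure].
  by move=> z /K0D[].
have bdDD x : bd D x -> ~ D x.
  by move=> [_ nDx] Dx; apply: nDx; apply: open_nbhs_nbhs.
pose t k z := tr Dr v eps0 (s k) z.
pose g k z := v z (t k z).
have tP k z : K0 z -> 0 <= t k z < eps0 /\ bd (Dr (s k)) (g k z).
  by move=> K0z; apply: (tr_attained Dr v eps0 K0 cv _ _ K0z); exact: hitP.
have clDrD r : r < 0 -> closure (Dr r) `<=` D.
  move=> r_lt0; have [||_ clDr] := Dr_nest r (r / 2).
  - by lra.
  - by lra.
  by rewrite -DrD => x /clDr Dx; exists (r / 2) => //=; lra.
have bdDrD r : r < 0 -> bd (Dr r) `<=` D by move=> r_lt0 x [] /(clDrD _ r_lt0).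
have s_lt0 k : s k < 0 by have /andP[] := s0 k.
have gD k z : K0 z -> D (g k z).
  by move=> /(tP k)[_]; exact: bdDrD.
(* Strict positivity is what lets the one-sided limit at 0 apply along the times [t k z]. *)
have t_gt0 k z : K0 z -> 0 < t k z.
  move=> K0z; have [/andP[t_ge0 _] _] := tP k _ K0z.
  rewrite lt_neqAle t_ge0 andbT eq_sym; apply/eqP => tkz0.
  apply: (bdDD z); first exact: K0D.
  by have := gD k _ K0z; rewrite /g tkz0 v0.
have t_cvg e : 0 < e -> exists k0, forall k, (k0 <= k)%N ->
    forall z, K0 z -> `|t k z| < e.
  move=> /tr0[d [d0 dP]]; have [k0 k0P] := sP _ d0.
  by exists k0 => k /k0P sk z K0z; exact: dP.
have g_close e : 0 < e -> exists k0, forall k, (k0 <= k)%N ->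
    forall z, K0 z -> ball z e (g k z).
  move=> e_gt0.
  have /nbhs_ballP[r /= r_gt0 rP] := radial_uniformly_close v eps0 K0 cv cptK0 v0 e00 _ e_gt0.
  have [k0 k0P] := t_cvg _ r_gt0; exists k0 => k k0k z K0z.
  apply: (rP (t k z)) => //; last by have [] := tP k _ K0z.
  by rewrite /ball/= sub0r normrN; exact: k0P.
have cg k : {within K0, continuous (g k)}.
  apply: (within_continuous_radial v eps0 K0 cv); last exact: ctr.
  by move=> z /(tP k)[].
have mBad : measurable Bad.
  rewrite (_ : Bad = `]-oo, a - eps[ `|` `]b + eps, +oo[)%classic.
    by apply: measurableU; exact: measurable_itv.
  by apply/seteqP; split => y; rewrite /Bad /= !in_itv/= andbT.
have mD : measurable (D : set (borelE R n)) by exact: borelE_open.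
have mDu (Y : set R) : measurable Y -> measurable (D `&` u @^-1` Y : set (borelE R n)).
  by move=> mY; exact: mu_u.
pose A k : set (borelE R n) := K0 `&` (u \o g k) @^-1` Bad.
have mA k : measurable (A k).
  have mK0 := borelE_closed _ cK0.
  (* [u] is Borel only on [D], but [g k] maps [K0] into [D], so intersecting with [D] changes
     nothing. *)
  have := within_continuous_measurable _ _ cK0 (cg k) mK0 _ (mDu _ mBad).
  rewrite (_ : _ `&` _ = A k)//.
  apply/seteqP; split => z [K0z]; first by case.
  by split=> //; split=> //; exact: gD.
have del16 : 0 < delta / 16 by rewrite divr_gt0.
(* [radlim] supplies the null set of points of [K0] without the radial limit. The bound becomes
   [delta / 16] after multiplication by [c]. *)
have [L [J [cL LA muJ]]] := limsup_closed_approx mu A _ muT mA radlim _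
  (divr_gt0 del16 c0).
have LK0 : L `<=` K0.
  by move=> z /LA[/(_ 0%N I)[k _ []]].
(* The threshold in the image estimate depends on the set, so it is applied to one set covering all
   late [A k] outside [L]. *)
pose Aex : set (borelE R n) := (\bigcup_(j in [set j | (J <= j)%N]) A j) `\` L.
have mAex : measurable Aex.
  by apply: measurableD; [exact: bigcup_measurable|exact: borelE_closed].
have AexK0 : Aex `<=` K0 by move=> z [[k _ []]].
have [d1 [d1_gt0 d1P]] := imP _ mAex AexK0 _ del16.
have [d2 [d2_gt0 d2P]] := missP _ del16.
have [k1 k1P] := sP _ d1_gt0.
have [k2 k2P] := sP _ d2_gt0.
(* Removing the closure of T costs no point of bd D outside L, because the
   images g k @` L lie inside D and converge uniformly to L. *)
pose T : set 'rV[R]_n := \bigcup_k g k @` L.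
have clT : closure T `&` bd D `<=` L.
  apply: (closure_bigcup_images g (fun k => closure (Dr (s k)))) => //.
  - by move=> k; exact: closed_closure.
  - move=> i j ij; have : s i <= s j by apply: homo_rj; rewrite leq_add2l.
    rewrite le_eqVlt => /predU1P[-> //|sij].
    have [_ clD] := Dr_nest _ _ sij (s_lt0 j).
    by apply: subset_trans clD _; exact: subset_closure.
  - move=> k; rewrite -subset0 => x [clx bdx].
    by apply: (bdDD _ bdx); exact: clDrD clx.
  - by move=> k z /LK0 /(tP k)[_ []].
  - move=> e /g_close[k0 k0P]; exists k0 => k k0k z /LK0; exact: k0P.
(* A point of [L] has bad values along infinitely many [k], yet these values converge to [ut z]. *)
have ut_notL z : a <= ut z < b -> ~ L z.
  move=> utz Lz; have [Az nNz] := LA _ Lz.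
  have {nNz} /(_ (LK0 _ Lz)) uz : K0 z -> (fun t => u (v z t)) @ 0^'+ --> ut z.
    exact: contrapT.
  have /cvgrPdist_lt/(_ _ eps_gt0) := uz.
  move=> /nbhs_ballP[r /= r_gt0 rP].
  have [k0 k0P] := t_cvg _ r_gt0.
  have [k /= k0k [K0z]] := Az k0 I.
  apply: (BadN a b eps (ut z)) => //; apply: rP; last exact: t_gt0.
  by rewrite /ball/= sub0r normrN; exact: k0P.
exists (j1 + maxn J (maxn k1 k2))%N, (~` closure T); split.
  by apply: closed_openC; exact: closed_closure.
split.
  move=> z [K0z utz]; split; last by have [] := K0D _ K0z.
  move=> clz; apply: (ut_notL _ utz); apply: clT; split=> //; exact: K0D.
move=> j jge.
have [k jE] : exists k, j = (j1 + k)%N.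
  by exists (j - j1)%N; rewrite subnKC// (leq_trans _ jge)// leq_addr.
move: jge; rewrite jE leq_add2l !geq_max => /and3P[Jk k1k k2k].
rewrite -/(s k); set nu := mur (s k).
have [_ [_ nubd]] := murP _ (s_lt0 k).
have nuD : msupp nu `<=` bd (Dr (s k)) by apply: msupp_sub => //; exact: closed_bd.
(* A bad point is missed by [g k] on [K0], or equals [g k z] with [z] in [A k]; then [z] is not in
   [L], as the point would lie in [T]. *)
have small (Y : set R) : measurable Y -> Y `<=` Bad ->
    (nu ([set x | msupp nu x /\ Y (u x)] `&` (~` closure T `&` closure D))
      < (delta / 4)%:E + (delta / 4)%:E)%E.
  move=> mY YBad.
  apply: (@lt_measure_outerU _ _ _ _
    (bd (Dr (s k)) `\` g k @` K0) (g k @` Aex)).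
  - rewrite (_ : _ `&` _ = (msupp nu `&` (~` closure T `&` closure D))
        `&` (D `&` u @^-1` Y)).
      apply: measurableI; last exact: mDu.
      apply: measurableI; first by apply: borelE_closed; exact: closed_msupp.
      apply: measurableI; last by apply: borelE_closed; exact: closed_closure.
      by apply: borelE_open; apply: closed_openC; exact: closed_closure.
    apply/seteqP; split=> x [].
      by move=> [nux Yx] Wx; split=> //; split=> //; apply: (bdDrD (s k)) => //; exact: nuD.
    by move=> [nux Wx] [Dx Yx].
  - move=> x [[nux Yx] [nTx _]].
    have [[z K0z zx]|ngx] := pselect ((g k @` K0) x); last first.
      by left; split=> //; exact: nuD.
    right; exists z => //; split.
      by exists k => //; split=> //=; rewrite zx; exact: YBad.
    move=> Lz; apply: nTx; apply: subset_closure.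
    by exists k => //; exists z.
  - apply: le_lt_trans (d2P _ _) _; first by rewrite k2P//=.
    by rewrite lte_fin.
  - apply: le_lt_trans (d1P _ _) _; first by rewrite k1P//=.
    apply: (@le_lt_trans _ _ ((delta / 16)%:E + (delta / 16)%:E)%E).
      apply: leeD => //.
      apply: (@le_trans _ _ (c%:E * (delta / 16 / c)%:E)%E).
        by apply: lee_wpmul2l; [rewrite lee_fin ltW|exact: ltW].
      by rewrite -EFinM lee_fin mulrC divfK// gt_eqF.
    by rewrite -EFinD lte_fin.
rewrite deltaE EFinD.
apply: lteD.
- apply: (small [set y | y < a - eps]); last by move=> y; left.
  rewrite (_ : mkset _ = `]-oo, a - eps[%classic); first exact: measurable_itv.
  by apply/seteqP; split => y; rewrite /= in_itv.
- apply: (small [set y | y > b + eps]); last by move=> y; right.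
  rewrite (_ : mkset _ = `]b + eps, +oo[%classic); first exact: measurable_itv.
  by apply/seteqP; split => y; rewrite /= in_itv/= andbT.
Qed.
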